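(* Consider a rigid bundle 2-gerbe on the manifold $X$, with surjective submersion $Y\to X$, semisimplicial submersion $Z_\bullet\to Y^{[\bullet+1]}$, and bundle gerbe $(E,Z_1)$ on $Y^{[2]}$, and assume that it has a connective structure $(\nabla_E,\beta,\lambda)$. Then the associated bundle 2-gerbe has connection $\nabla_E$, curving $\beta$ and 2-curving $\lambda$ (in the sense of Stevenson), all of which are exactly the same pieces of data as for the rigid bundle 2-gerbe.
   Context: Manifolds are smooth Fréchet manifolds. For a surjective submersion $Y\to X$, $Y^{[k]}$ is the $k$-fold fibre product, $d_i\colon Y^{[k]}\to Y^{[k-1]}$ omits the $(i+1)$-th factor. On a semisimplicial manifold, $\delta\omega=\sum(-1)^id_i^*\omega$ for forms and $\delta E=d_0^*E\otimes d_1^*E^*\otimes d_2^*E\otimes\cdots$ for principal $U(1)$-bundles, with induced sections and connections. A bundle gerbe $(E,Y)$ on $X$ is a $U(1)$-bundle $E\to Y^{[2]}$ with a section $m$ of $\delta E$ such that $\delta(m)=1$ (the canonical section of $\delta^2E$); a bundle gerbe connection is a connection $\nabla$ on $E$ with $m^*\delta\nabla=0$; a curving is $b\in\Omega^2(Y)$ with $\delta b=\mathrm{curv}(\nabla)$; the 3-curvature is the 3-form on $X$ pulling back to $db$. A rigid bundle 2-gerbe on $X$: (1) a surjective submersion $Y\to X$; (2) a 3-truncated semisimplicial manifold $Z_\bullet$ with a degreewise surjective submersion $\pi\colon Z_\bullet\to Y^{[\bullet+1]}$ of semisimplicial manifolds ($Z_n^{[k]}$: fibre products over $Y^{[n+1]}$;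 $\delta_h,\delta_v$: $\delta$ for $Z_n^{[k]}\to Z_{n-1}^{[k]}$, resp. $Z_n^{[k]}\to Z_n^{[k-1]}$); (3) a $U(1)$-bundle $E\to Z_1^{[2]}$ and section $m$ of $\delta_vE$ making $(E,Z_1)$ a bundle gerbe on $Y^{[2]}$; (4) a section $M$ of $\delta_hE\to Z_2^{[2]}$; (5) $\delta_v(M)=\delta_h(m)$, $\delta_h(M)=1$. A connective structure is $(\nabla_E,\beta,\lambda)$ with $\nabla_E$ a bundle gerbe connection on $(E,Z_1)$, $\beta\in\Omega^2(Z_1)$ with $\delta_v\beta=\mathrm{curv}(\nabla_E)$, $\lambda\in\Omega^3(Y)$ with $\pi^*\delta_h\lambda=d\beta$. A (weak) bundle 2-gerbe on $X$ consists of a surjective submersion $Y\to X$, a bundle gerbe $\mathcal E$ on $Y^{[2]}$, and further a multiplication stable isomorphism over $Y^{[3]}$ and a coherent associator over $Y^{[4]}$. A connection, curving and 2-curving on it (Stevenson) involve only $Y$ and $\mathcal E$: a bundle gerbe connection and a curving on $\mathcal E$ whose 3-curvature $H\in\Omega^3(Y^{[2]})$ satisfies $\delta(H)=0$, and a 2-curving $\lambda\in\Omega^3(Y)$ with $\delta(\lambda)=H$. The bundle 2-gerbe associated to a rigid bundle 2-gerbe has the same submersion $Y\to X$ and bundle gerbe $\mathcal E=(E,Z_1)$ on $Y^{[2]}$, with multiplication and associator constructed from $M$. *)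

(* Defs.v *)
From HB Require Import structures.
From mathcomp Require Import all_boot all_order all_algebra.
From mathcomp Require Import all_classical all_reals all_analysis.
From mathcomp Require Import complex.
Set Implicit Arguments.
Unset Strict Implicit.
Unset Printing Implicit Defensive.
Import Order.TTheory GRing.Theory Num.Theory.
Import numFieldNormedType.Exports.
Local Open Scope classical_set_scope.
Local Open Scope ring_scope.

(** * Calculus in Fréchet spaces *)

(* [tvsType] is the library's locally convex space.  Its uniform structure is
   only required to induce the topology, so completeness is stated for the
   uniform structure of the additive group: a filter is Cauchy when the
   differences of its elements tend to 0. *)
Record frechetType (R : realType) := FrechetType {
  frechet_sort :> tvsType R;
  frechet_hausdorff : hausdorff_space frechet_sort;
  frechet_countable : exists B : nat -> set frechet_sort,
    (forall n, nbhs (0 : frechet_sort) (B n)) /\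
    (forall U, nbhs (0 : frechet_sort) U -> exists n, B n `<=` U);
  frechet_complete : forall F : set_system frechet_sort, ProperFilter F ->
    (fun p : frechet_sort * frechet_sort => p.1 - p.2) @ filter_prod F F
      --> (0 : frechet_sort) ->
    exists l : frechet_sort, F --> l }.

Section calculus.
Context {R : realType}.

(* The library's ['D_v f x] and [derivable] are restricted to normed modules;
   these are the same definitions for locally convex spaces. *)
Definition dquot (E F : tvsType R) (f : E -> F) (x v : E) (h : R) : F :=
  h^-1 *: (f (h *: v + x) - f x).

Definition ddir (E F : tvsType R) (f : E -> F) (x v : E) : F :=
  xget 0 [set l : F | dquot f x v h @[h --> (0 : R)^'] --> l].

Definition has_ddir (E F : tvsType R) (f : E -> F) (x v : E) : Prop :=
  exists l : F, dquot f x v h @[h --> (0 : R)^'] --> l.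

(* C^n in the sense of Michal-Bastiani (= Hamilton) on an open set A. *)
Fixpoint Cn (n : nat) (E F : tvsType R) (A : set E) (f : E -> F) : Prop :=
  (forall x, A x -> {for x, continuous f}) /\
  if n is n'.+1 then
    (forall x v, A x -> has_ddir f x v) /\
    @Cn n' (E * E)%type F [set p | A p.1] (fun p => ddir f p.1 p.2)
  else True.

Definition smooth_on (E F : tvsType R) (A : set E) (f : E -> F) : Prop :=
  forall n, Cn n A f.

End calculus.

(** * Fréchet manifolds *)

Record manifold (R : realType) := Manifold {
  mpt :> topologicalType;
  mhausdorff : hausdorff_space mpt;
  chart : Type;
  model : chart -> frechetType R;
  dom : chart -> set mpt;
  phi : forall i, mpt -> model i;
  psi : forall i, model i -> mpt;
  chart_at : mpt -> chart;
  dom_chart_at : forall p, dom (chart_at p) p;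
  dom_open : forall i, open (dom i);
  img_open : forall i, open (@phi i @` dom i);
  phiK : forall i p, dom i p -> psi (phi i p) = p;
  phi_continuous : forall i p, dom i p -> {for p, continuous (phi i)};
  psi_continuous : forall i x, (phi i @` dom i) x -> {for x, continuous (@psi i)};
  transition_smooth : forall i j,
    smooth_on (phi i @` (dom i `&` dom j)) (phi j \o @psi i) }.

Arguments chart {R}.
Arguments model {R m}.
Arguments dom {R m}.
Arguments phi {R m}.
Arguments psi {R m}.
Arguments chart_at {R m}.

Section manifolds.
Context {R : realType}.
Implicit Types M N B X : manifold R.

Definition img M (U : set M) (i : chart M) : set (model i) :=
  phi i @` (dom i `&` U).
#[global] Arguments img {M} U i _.

Definition smooth_map M N (f : M -> N) : Prop :=
  continuous f /\
  forall i j, smooth_on (img (f @^-1` dom j) i) (phi j \o f \o psi i).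

Definition smooth_fun_on M (U : set M) (f : M -> R) : Prop :=
  forall i, smooth_on (img U i) (f \o psi i : model i -> R^o).

(* Near each point f is, in charts, the projection of a product of Fréchet
   spaces onto its first factor: there is a such that (f, a) is a diffeomorphism
   from a neighbourhood O onto the open set W, with inverse b. *)
Definition submersion M N (f : M -> N) : Prop :=
  smooth_map f /\
  forall p : M, let i := chart_at p in let j := chart_at (f p) in
  exists (F : frechetType R) (O : set (model i)) (W : set (model j * F))
         (a : model i -> F) (b : model j * F -> model i),
    let g := fun x => (phi j (f (psi i x)), a x) in
    [/\ open O, O (phi i p), O `<=` img (f @^-1` dom j) i & open W] /\
    [/\ smooth_on O (g : _ -> (model j * F)%type), smooth_on W b,
        g @` O = W & forall x, O x -> b (g x) = x].

Definition surjective_submersion M N (f : M -> N) : Prop :=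
  submersion f /\ forall q : N, exists p : M, f p = q.

(* k-fold fibre power of M over B, by its universal property among Fréchet
   manifolds, so that it is determined up to diffeomorphism. *)
Definition is_fibre_power M B (f : M -> B) (k : nat) (P : manifold R)
    (pr : 'I_k -> P -> M) : Prop :=
  [/\ forall i, smooth_map (pr i),
      forall i j z, f (pr i z) = f (pr j z) &
      forall (T : manifold R) (t : 'I_k -> T -> M),
        (forall i, smooth_map (t i)) ->
        (forall i j z, f (t i z) = f (t j z)) ->
        exists! u : T -> P, smooth_map u /\ forall i z, pr i (u z) = t i z].

(** * Differential forms *)

(* A form is given by its expressions in the charts.  The values of a [preform]
   outside the images of the charts are irrelevant; equality of forms is
   [eqform], and [is_form] says that a preform is an actual (smooth) form.  The
   operations below (pullback: along smooth maps) preserve [is_form]. *)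
Definition preform (k : nat) M : Type :=
  forall i : chart M, model i -> ('I_k -> model i) -> R.

Fixpoint pow (E : tvsType R) (k : nat) : tvsType R :=
  if k is k'.+1 then (pow E k' * E)%type else E.

Fixpoint pow_base (E : tvsType R) (k : nat) : pow E k -> E :=
  match k with 0 => fun p => p | k'.+1 => fun p => @pow_base E k' p.1 end.

Fixpoint pow_vec (E : tvsType R) (k : nat) : pow E k -> nat -> E :=
  match k with
  | 0 => fun _ _ => 0
  | k'.+1 => fun p l => if l == k' then p.2 else @pow_vec E k' p.1 l
  end.

Definition subst_vec (k : nat) (E : Type) (v : 'I_k -> E) (l : 'I_k) (u : E) :=
  fun l' => if l' == l then u else v l'.

Definition is_form_on k M (U : set M) (w : preform k M) : Prop :=
  [/\ forall i x v l (a : R) (u u' : model i), img U i x ->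
        w i x (subst_vec v l (a *: u + u')) =
        a * w i x (subst_vec v l u) + w i x (subst_vec v l u'),
      forall i x v l l', img U i x -> l != l' -> v l = v l' -> w i x v = 0,
      forall i, smooth_on [set p : pow (model i) k | img U i (pow_base p)]
        (fun p => w i (pow_base p) (fun l : 'I_k => pow_vec p l) : R^o) &
      forall i j x v, img (U `&` dom j) i x ->
        w i x v = w j (phi j (psi i x))
                    (fun l => ddir (phi j \o psi i) x (v l))].

Definition is_form k M (w : preform k M) : Prop := is_form_on setT w.

Definition eqform_on k M (U : set M) (w w' : preform k M) : Prop :=
  forall i x v, img U i x -> w i x v = w' i x v.

Definition eqform k M (w w' : preform k M) : Prop := eqform_on setT w w'.

Definition zero_form k M : preform k M := fun _ _ _ => 0.
#[global] Arguments zero_form {k} M _ _ _.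

Definition add_form k M (w w' : preform k M) : preform k M :=
  fun i x v => w i x v + w' i x v.
#[global] Arguments add_form {k M} w w' _ _ _.

Definition scale_form k M (a : R) (w : preform k M) : preform k M :=
  fun i x v => a * w i x v.
#[global] Arguments scale_form {k M} a w _ _ _.

(* The usual formula, with the vectors v extended to constant vector fields. *)
Definition extd k M (w : preform k M) : preform k.+1 M := fun i x v =>
  \sum_(l < k.+1) (-1) ^+ l *
    ddir (fun y => w i y (fun l' : 'I_k => v (lift l l')) : R^o) x (v l).
#[global] Arguments extd {k M} w _ _ _.

Definition pull_form k M N (f : M -> N) (w : preform k N) : preform k M :=
  fun i x v => let j := chart_at (f (psi i x)) in
    w j (phi j (f (psi i x))) (fun l => ddir (phi j \o f \o psi i) x (v l)).
#[global] Arguments pull_form {k M N} f w _ _ _.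

Definition delta_form k M N n (f : 'I_n.+1 -> M -> N) (w : preform k N) :
    preform k M :=
  fun i x v => \sum_(l < n.+1) (-1) ^+ l * pull_form (f l) w i x v.
#[global] Arguments delta_form {k M N n} f w _ _ _.

End manifolds.

(** * U(1)-torsors *)

Section torsors.
Context {R : realType}.

Record U1 := MkU1 { u1val : R[i]; u1P : `|u1val| = 1 }.

Lemma u1_inj (z w : U1) : u1val z = u1val w -> z = w.
Proof. by case: z w => [z hz] [w hw] /= e; subst w; congr MkU1. Qed.

Lemma u1one_subproof : `|1 : R[i]| = 1. Proof. exact: normr1. Qed.
Definition u1one := MkU1 u1one_subproof.

Lemma u1mul_subproof (z w : U1) : `|u1val z * u1val w| = 1.
Proof. by rewrite normrM !u1P mulr1. Qed.
Definition u1mul z w := MkU1 (u1mul_subproof z w).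

Lemma u1inv_subproof (z : U1) : `|(u1val z)^-1| = 1.
Proof. by rewrite normfV u1P invr1. Qed.
Definition u1inv z := MkU1 (u1inv_subproof z).

Lemma u1mulA z w t : u1mul z (u1mul w t) = u1mul (u1mul z w) t.
Proof. by apply: u1_inj; rewrite /= mulrA. Qed.
Lemma u1mulC z w : u1mul z w = u1mul w z.
Proof. by apply: u1_inj; rewrite /= mulrC. Qed.
Lemma u1mul1 z : u1mul u1one z = z.
Proof. by apply: u1_inj; rewrite /= mul1r. Qed.
Lemma u1mulV z : u1mul z (u1inv z) = u1one.
Proof.
by apply: u1_inj; rewrite /= mulfV// -normr_eq0 u1P oner_eq0.
Qed.
Lemma u1inv1 : u1inv u1one = u1one.
Proof. by apply: u1_inj; rewrite /= invr1. Qed.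
Lemma u1invM z w : u1inv (u1mul z w) = u1mul (u1inv z) (u1inv w).
Proof. by apply: u1_inj; rewrite /= invfM. Qed.
Lemma u1invK z : u1inv (u1inv z) = z.
Proof. by apply: u1_inj; rewrite /= invrK. Qed.

Record torsor := Torsor {
  tpt :> Type;
  tact : U1 -> tpt -> tpt;
  tact1 : forall p, tact u1one p = p;
  tactM : forall z w p, tact (u1mul z w) p = tact z (tact w p);
  tact_transitive : forall p q, exists z, q = tact z p;
  tact_free : forall z w p, tact z p = tact w p -> z = w;
  tinhabited : inhabited tpt }.

(* The element by which q differs from p: q = tact (tdiff p q) p. *)
Definition tdiff (T : torsor) (p q : T) : U1 :=
  projT1 (cid (tact_transitive p q)).

Lemma tdiffP (T : torsor) (p q : T) : q = tact (tdiff p q) p.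
Proof. by rewrite /tdiff; case: cid. Qed.

Section twist.
Variables (b : bool) (T : torsor).
Let sgn z := if b then u1inv z else z.
Definition twist_act (z : U1) (p : T) : T := tact (sgn z) p.

Lemma twist_act1 p : twist_act u1one p = p.
Proof. by rewrite /twist_act /sgn u1inv1 if_same tact1. Qed.
Lemma twist_actM z w p : twist_act (u1mul z w) p = twist_act z (twist_act w p).
Proof. by rewrite /twist_act /sgn; case: b; rewrite ?u1invM tactM. Qed.
Lemma twist_transitive p q : exists z, q = twist_act z p.
Proof.
by exists (sgn (tdiff p q)); rewrite /twist_act /sgn; case: b;
  rewrite ?u1invK -tdiffP.
Qed.
Lemma twist_free z w p : twist_act z p = twist_act w p -> z = w.
Proof.
rewrite /twist_act /sgn => /tact_free; case: b => // e.
by rewrite -(u1invK z) e u1invK.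
Qed.

(* T, or its dual T^* if b is true: as a set T^* is T, with the inverse
   action. *)
Definition twist : torsor := Torsor twist_act1 twist_actM twist_transitive
  twist_free (tinhabited T).
End twist.

(* The contracted product: the quotient of T * S by the relation
   (z p, q) ~ (p, z q), realized as the set of equivalence classes. *)
Section tensor.
Variables T S : torsor.

Definition tclass (p : T) (q : S) : set (T * S) :=
  [set r | exists z, r = (tact z p, tact (u1inv z) q)].

Record tensor_pt := TensorPt {
  tensor_set : set (T * S);
  tensor_setP : exists p q, tensor_set = tclass p q }.

Lemma tensor_pt_inj A B : tensor_set A = tensor_set B -> A = B.
Proof.
case: A B => [A hA] [B hB] /= e; subst B; congr TensorPt; exact: Prop_irrelevance.
Qed.

Lemma tclass_ex p q : exists p' q', tclass p q = tclass p' q'.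
Proof. by exists p, q. Qed.
Definition pure (p : T) (q : S) : tensor_pt := TensorPt (tclass_ex p q).

Lemma pureP A : exists p q, A = pure p q.
Proof.
by case: (tensor_setP A) => p [q e]; exists p, q; apply: tensor_pt_inj.
Qed.

Lemma pure_eq p q p' q' :
  pure p q = pure p' q' <-> exists z, p' = tact z p /\ q' = tact (u1inv z) q.
Proof.
split=> [[e]|[z [-> ->]]].
  have : tclass p' q' (p', q').
    by exists u1one; rewrite u1inv1 !tact1.
  by rewrite -e => -[z [-> ->]]; exists z.
apply: tensor_pt_inj; apply/seteqP; split=> r [w ->] /=.
  exists (u1mul w (u1inv z)); rewrite u1invM u1invK -!tactM -!u1mulA.
  by rewrite (u1mulC _ z) u1mulV !(u1mulC _ u1one) !u1mul1.
by exists (u1mul w z); rewrite u1invM !tactM.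
Qed.

Lemma tensor_act_subproof z (A : tensor_pt) :
  exists p q, [set r | exists p' q', tensor_set A (p', q') /\
                 r = (tact z p', q')] = tclass p q.
Proof.
case: (tensor_setP A) => p [q ->]; exists (tact z p), q.
apply/seteqP; split=> r /=.
  by move=> [p' [q' [[w [-> ->]] ->]]]; exists w; rewrite -!tactM u1mulC.
move=> [w ->]; exists (tact w p), (tact (u1inv w) q).
by split; [exists w | rewrite -!tactM u1mulC].
Qed.
Definition tensor_act z A := TensorPt (tensor_act_subproof z A).

Lemma tensor_act_pure z p q : tensor_act z (pure p q) = pure (tact z p) q.
Proof.
apply: tensor_pt_inj; apply/seteqP; split=> r /=.
  by move=> [p' [q' [[w [-> ->]] ->]]]; exists w; rewrite -!tactM u1mulC.
move=> [w ->]; exists (tact w p), (tact (u1inv w) q).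
by split; [exists w | rewrite -!tactM u1mulC].
Qed.

Lemma tensor_act1 A : tensor_act u1one A = A.
Proof. by case: (pureP A) => p [q ->]; rewrite tensor_act_pure tact1. Qed.
Lemma tensor_actM z w A :
  tensor_act (u1mul z w) A = tensor_act z (tensor_act w A).
Proof. by case: (pureP A) => p [q ->]; rewrite !tensor_act_pure tactM. Qed.
Lemma tensor_transitive A B : exists z, B = tensor_act z A.
Proof.
case: (pureP A) (pureP B) => p [q ->] [p' [q' ->]].
exists (u1mul (tdiff q q') (tdiff p p')).
rewrite tensor_act_pure tactM -tdiffP; apply/esym/pure_eq.
exists (u1inv (tdiff q q')); rewrite u1invK -tdiffP -tactM.
by rewrite u1mulC u1mulV tact1.
Qed.
Lemma tensor_free z w A : tensor_act z A = tensor_act w A -> z = w.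
Proof.
case: (pureP A) => p [q ->]; rewrite !tensor_act_pure => /pure_eq[t []].
rewrite -tactM => /tact_free -> qt.
have -> : t = u1one.
  have : tact u1one q = tact (u1inv t) q by rewrite tact1.
  by move/tact_free => e; rewrite -(u1invK t) -e u1inv1.
by rewrite u1mul1.
Qed.
Lemma tensor_inhabited : inhabited tensor_pt.
Proof.
by case: (tinhabited T) (tinhabited S) => p [q]; exact: (inhabits (pure p q)).
Qed.

Definition tensor : torsor := Torsor tensor_act1 tensor_actM tensor_transitive
  tensor_free tensor_inhabited.
End tensor.

End torsors.
Arguments U1 : clear implicits.
Arguments torsor : clear implicits.

(** * Principal U(1)-bundles and connections *)

Section bundles.
Context {R : realType}.
Implicit Types M N B : manifold R.

(* The smooth structure of a U(1)-bundle is given by a bundle atlas: a family of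
   local sections [tsec j], meaningful over the open sets [tdom j].  [is_bundle]
   says that these cover the base and have smooth transition functions.  The
   operations below (pullback: along smooth maps) preserve [is_bundle]. *)
Record prebundle M := PreBundle {
  fib :> M -> torsor R;
  triv : Type;
  tdom : triv -> set M;
  tsec : triv -> forall x, fib x }.

Definition u1_smooth_on M (U : set M) (g : M -> U1 R) : Prop :=
  smooth_fun_on U (fun x => complex.Re (u1val (g x))) /\
  smooth_fun_on U (fun x => complex.Im (u1val (g x))).

Definition is_bundle M (E : prebundle M) : Prop :=
  [/\ forall j : triv E, open (tdom j),
      forall x, exists j : triv E, tdom j x &
      forall j k : triv E, u1_smooth_on (tdom j `&` tdom k)
        (fun x => tdiff (tsec j x) (tsec k x))].

Definition set_section M (E : prebundle M) : Type := forall x : M, E x.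

Definition smooth_section M (E : prebundle M) (s : set_section E) : Prop :=
  forall j : triv E, u1_smooth_on (tdom j) (fun x => tdiff (tsec j x) (s x)).

Definition pull_bundle M N (f : M -> N) (E : prebundle N) : prebundle M :=
  @PreBundle M (fun x => E (f x)) (triv E) (fun j => f @^-1` tdom j)
    (fun j x => tsec j (f x)).

Definition twist_bundle (b : bool) M (E : prebundle M) : prebundle M :=
  @PreBundle M (fun x => twist b (E x)) (triv E) (@tdom _ E) (@tsec _ E).

Definition tensor_bundle M (E F : prebundle M) : prebundle M :=
  @PreBundle M (fun x => tensor (E x) (F x)) (triv E * triv F)%type
    (fun j => tdom j.1 `&` tdom j.2)
    (fun j x => pure (tsec j.1 x) (tsec j.2 x)).

(* The bundle d_0^*E (x) d_1^*E^* (x) d_2^*E (x) ... (x) d_n^*E^((-1)^n), for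
   maps d_0, ..., d_n, and the section and the connection induced on it by a
   section and a connection on E. *)
Fixpoint delta_bundle M N (n : nat) :
    ('I_n.+1 -> M -> N) -> prebundle N -> prebundle M :=
  match n with
  | 0 => fun d E => pull_bundle (d ord0) E
  | n'.+1 => fun d E =>
      tensor_bundle (@delta_bundle M N n' (d \o widen_ord (leqnSn n'.+1)) E)
                    (twist_bundle (odd n'.+1) (pull_bundle (d ord_max) E))
  end.

Fixpoint delta_section M N (n : nat) :
    forall (d : 'I_n.+1 -> M -> N) (E : prebundle N),
    set_section E -> set_section (delta_bundle d E) :=
  match n with
  | 0 => fun d E s x => s (d ord0 x)
  | n'.+1 => fun d E s x =>
      pure (@delta_section M N n' (d \o widen_ord (leqnSn n'.+1)) E s x)
           (s (d ord_max x) : twist (odd n'.+1) (E (d ord_max x)))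
  end.

#[global] Arguments delta_section {M N n} d {E} s x.

(* The Lie algebra of U(1) is identified with R (that is, iR divided by i).
   [dlog g] is g^-1 dg = i (a db - b da) for g = a + ib, divided by i. *)
Definition dlog M (g : M -> U1 R) : preform 1 M := fun i x v =>
  let a : model i -> R^o := fun y => complex.Re (u1val (g (psi i y))) in
  let b : model i -> R^o := fun y => complex.Im (u1val (g (psi i y))) in
  a x * ddir b x (v ord0) - b x * ddir a x (v ord0).
#[global] Arguments dlog {M} g _ _ _.

(* A connection, given by the local connection forms (tsec j)^* A. *)
Definition preconn M (E : prebundle M) : Type := triv E -> preform 1 M.

Definition is_connection M (E : prebundle M) (A : preconn E) : Prop :=
  (forall j, is_form_on (tdom j) (A j)) /\
  forall j k, eqform_on (tdom j `&` tdom k) (A k)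
    (add_form (A j) (dlog (fun x => tdiff (tsec j x) (tsec k x)))).

Fixpoint delta_conn M N (n : nat) :
    forall (d : 'I_n.+1 -> M -> N) (E : prebundle N),
    preconn E -> preconn (delta_bundle d E) :=
  match n with
  | 0 => fun d E A j => pull_form (d ord0) (A j)
  | n'.+1 => fun d E A j =>
      add_form (@delta_conn M N n' (d \o widen_ord (leqnSn n'.+1)) E A j.1)
               (scale_form ((-1) ^+ odd n'.+1)
                  (pull_form (d ord_max) (A j.2)))
  end.

#[global] Arguments delta_conn {M N n} d {E} A _ _ _ _.

(* s^*A = 0 *)
Definition flat_section M (E : prebundle M) (A : preconn E)
    (s : set_section E) : Prop :=
  forall j, eqform_on (tdom j)
    (add_form (A j) (dlog (fun x => tdiff (tsec j x) (s x)))) (zero_form M).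

(* F = curv(A) *)
Definition is_curvature M (E : prebundle M) (A : preconn E) (F : preform 2 M) :=
  forall j, eqform_on (tdom j) F (extd (A j)).

(* For a section s of delta E, where d and d' are two consecutive levels of
   face maps of a semisimplicial manifold: delta(s) = 1.  The canonical section
   of delta(delta E) is delta(delta e), for any choice e of an element in each
   fibre of E; by the semisimplicial identities every e y occurs twice with
   opposite signs, so that delta(delta e) does not depend on e. *)
Definition delta_trivial (L M N : manifold R) n n' (d' : 'I_n'.+1 -> L -> M)
    (d : 'I_n.+1 -> M -> N) (E : prebundle N)
    (s : set_section (delta_bundle d E)) : Prop :=
  forall (e : set_section E) (x : L),
    delta_section d' s x = delta_section d' (delta_section d e) x.

End bundles.

(** * Bundle gerbes *)

Section gerbes.
Context {R : realType}.
Implicit Types B X : manifold R.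

(* A surjective submersion [aug] from Y = [fpow 0] to B together with the
   manifolds [fpow k] = Y^[k+1], their projections to Y, and the face maps. *)
Record precech B := PreCech {
  fpow :> nat -> manifold R;
  aug : fpow 0 -> B;
  proj : forall k, 'I_k.+1 -> fpow k -> fpow 0;
  face : forall k, 'I_k.+2 -> fpow k.+1 -> fpow k }.

Definition is_cech B (Y : precech B) : Prop :=
  [/\ surjective_submersion (@aug B Y),
      forall k, is_fibre_power (@aug B Y) (@proj B Y k),
      forall y : Y 0, proj ord0 y = y,
      forall k i, smooth_map (@face B Y k i) &
      forall k (i : 'I_k.+2) (j : 'I_k.+1) (y : Y k.+1),
        proj j (face i y) = proj (lift i j) y].

Definition is_bundle_gerbe B (Y : precech B) (E : prebundle (Y 1))
    (m : set_section (delta_bundle (@face B Y 1) E)) : Prop :=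
  [/\ is_cech Y, is_bundle E, smooth_section m &
      delta_trivial (@face B Y 2) m].

Record bundle_gerbe B := BundleGerbe {
  gcech : precech B;
  gbundle : prebundle (gcech 1);
  gmult : set_section (delta_bundle (@face B gcech 1) gbundle);
  gerbeP : is_bundle_gerbe gmult }.

Definition is_gerbe_connection B (G : bundle_gerbe B)
    (A : preconn (gbundle G)) : Prop :=
  is_connection A /\ flat_section (delta_conn (@face B (gcech G) 1) A) (gmult (b := G)).

Definition is_curving B (G : bundle_gerbe B) (A : preconn (gbundle G))
    (b : preform 2 (gcech G 0)) : Prop :=
  is_form b /\ is_curvature A (delta_form (@face B (gcech G) 0) b).

Definition is_3curvature B (G : bundle_gerbe B) (b : preform 2 (gcech G 0))
    (H : preform 3 B) : Prop :=
  is_form H /\ eqform (pull_form (@aug B (gcech G)) H) (extd b).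

(** * Bundle 2-gerbes *)

(* The submersion and the bundle gerbe of a bundle 2-gerbe on X, which are the
   part of it entering in Stevenson's definition of its connections, curvings
   and 2-curvings.  The multiplication and the associator are left out. *)
Record bundle_2gerbe_core X := Bundle2GerbeCore {
  bY : precech X;
  bYP : is_cech bY;
  bG : bundle_gerbe (bY 1) }.

Definition is_stevenson_structure X (T : bundle_2gerbe_core X)
    (A : preconn (gbundle (bG T))) (b : preform 2 (gcech (bG T) 0))
    (lambda : preform 3 (bY T 0)) : Prop :=
  [/\ is_gerbe_connection A, is_curving A b, is_form lambda &
      exists H : preform 3 (bY T 1),
        [/\ is_3curvature b H,
            eqform (delta_form (@face X (bY T) 1) H) (zero_form _) &
            eqform (delta_form (@face X (bY T) 0) lambda) H]].

(* [rZ n k] is Z_n^[k+1], with vertical face maps [face] and horizontal face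
   maps [hface].  Z is 3-truncated: nothing is required of [rZ n] for n > 3. *)
Record rigid_bundle_2gerbe X := RigidBundle2Gerbe {
  rY : precech X;
  rYP : is_cech rY;
  rZ : forall n, precech (rY n);
  rZP : forall n, (n <= 3)%N -> is_cech (rZ n);
  hface : forall n k, 'I_n.+2 -> rZ n.+1 k -> rZ n k;
  hface_smooth : forall n k i, (n < 3)%N -> smooth_map (@hface n k i);
  hface_hface : forall n (i j : 'I_n.+2) (z : rZ n.+2 0), (n.+1 < 3)%N ->
    (i <= j)%N ->
    hface i (hface (lift ord0 j) z) =
    hface j (hface (widen_ord (leqnSn n.+2) i) z);
  aug_hface : forall n i (z : rZ n.+1 0), (n < 3)%N ->
    aug (hface i z) = face i (aug z);
  proj_hface : forall n k i (j : 'I_k.+1) (z : rZ n.+1 k), (n < 3)%N ->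
    proj j (hface i z) = hface i (proj j z);
  rE : prebundle (rZ 1 1);
  rm : set_section (delta_bundle (@face _ (rZ 1) 1) rE);
  rgerbeP : is_bundle_gerbe rm;
  rM : set_section (delta_bundle (@hface 1 1) rE);
  rM_smooth : smooth_section rM;
  (* delta_v(M) = delta_h(m): the canonical isomorphism between
     delta_v(delta_h E) and delta_h(delta_v E) maps delta_v(delta_h e) to
     delta_h(delta_v e) for any choice e of an element in each fibre of E. *)
  rM_rm : forall (e : set_section rE) (x : rZ 2 2),
    tdiff (delta_section (@face _ (rZ 2) 1) (delta_section (@hface 1 1) e) x)
          (delta_section (@face _ (rZ 2) 1) rM x) =
    tdiff (delta_section (@hface 1 2) (delta_section (@face _ (rZ 1) 1) e) x)
          (delta_section (@hface 1 2) rm x);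
  rM_trivial : delta_trivial (@hface 2 1) rM }.

Definition rgerbe X (G : rigid_bundle_2gerbe X) : bundle_gerbe (rY G 1) :=
  BundleGerbe (rgerbeP G).

Definition is_connective_structure X (G : rigid_bundle_2gerbe X)
    (A : preconn (rE G)) (b : preform 2 (rZ G 1 0))
    (lambda : preform 3 (rY G 0)) : Prop :=
  [/\ @is_gerbe_connection _ (rgerbe G) A, @is_curving _ (rgerbe G) A b,
      is_form lambda &
      eqform (pull_form (@aug _ (rZ G 1)) (delta_form (@face _ (rY G) 0) lambda))
             (extd b)].

Definition associated_bundle_2gerbe X (G : rigid_bundle_2gerbe X) :
    bundle_2gerbe_core X :=
  Bundle2GerbeCore (rYP G) (rgerbe G).

End gerbes.

(* Main.v *)
Require Import Defs.
From mathcomp Require Import all_boot all_order all_algebra.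
From mathcomp Require Import all_classical all_reals all_analysis.
From mathcomp Require Import lra ring zify.
Set Implicit Arguments.
Unset Strict Implicit.
Unset Printing Implicit Defensive.
Import Order.TTheory GRing.Theory Num.Theory.
Import numFieldNormedType.Exports.
Local Open Scope classical_set_scope.
Local Open Scope ring_scope.

(** The 2-curving condition leaves no choice for the 3-curvature: it must be
    H = delta(lambda) on Y^[2].  With this H, the identity pi^* H = d(beta)
    required of a 3-curvature is word for word the last condition on a
    connective structure, and everything about the bundle gerbe (E, Z_1), its
    connection and its curving is shared by the two notions.  What has to be
    proved is that H is a differential form and that delta(H) = 0.

    Both facts rest on the functoriality of the pullback of forms: the pullback
    of a form along a smooth map is a form ([is_form_pull]), pullbacks compose
    ([pull_form_comp]), and so the sum defining delta(delta(lambda)) cancels in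
    pairs ([delta_delta_form]) by the semisimplicial identities between the
    projections Y^[3] -> Y^[2] -> Y.  Those identities hold because a map into a
    fibre power is determined by its components ([cech_faces]).

    Functoriality of the pullback is the chain rule, which for maps between
    locally convex spaces that are C^1 in the sense of Michal and Bastiani
    (directional derivatives exist and are jointly continuous) is derived here
    from a mean value theorem ([mean_value]): if the derivative of a curve
    stays in an open convex set, so does its increment over the unit interval.
    Hence the difference quotient of a C^1 map converges also when its base
    point and its direction vary ([dquot_cvg]); this gives at once the chain
    rule ([ddir_comp]) and the linearity of the derivative ([ddir_linear]), and,
    by induction on the order, the stability of smooth maps under composition
    ([Cn_comp]). *)

(** * The mean value theorem in a locally convex space *)

Section mean_value.
Context {R : realType}.

(** [convex_set] with a plain real coefficient instead of an element of the
    interval type used by the library. *)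
Definition is_convex (F : lmodType R) (U : set F) :=
  forall a b l, U a -> U b -> 0 <= l -> l <= 1 -> U (l *: a + (1 - l) *: b).

Lemma locally_convex_nbhs (F : tvsType R) (y : F) (W : set F) : nbhs y W ->
  exists U : set F, [/\ open U, U y, U `<=` W & is_convex U].
Proof.
move=> yW; have [B Bconv [Bopen Bnbhs]] := @locally_convex R F.
have [U /= [BU Uy] UW] := Bnbhs y _ yW.
exists U; split => //; first exact: Bopen.
move=> a b l Ua Ub l0 l1.
have := Bconv U (mem_set BU) a b (Itv01 l0 l1) (mem_set Ua) (mem_set Ub).
by rewrite inE.
Qed.

(** The slope of [c] over [a, d] is a convex combination of its slopes over
    [a, b] and [b, d], and near each point s the slopes over intervals with
    endpoint s lie in U.  So the supremum of the s for which the slope over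
    [0, s] lies in U is attained, and it cannot be less than 1. *)
Lemma mean_value (F : lmodType R) (U : set F) (c : R -> F) : is_convex U ->
  (forall s, 0 <= s -> s <= 1 ->
    \forall h \near (0 : R)^', U (h^-1 *: (c (h + s) - c s))) ->
  U (c 1 - c 0).
Proof.
move=> Uconv dc.
pose sl a b := (b - a)^-1 *: (c b - c a).
have slD a b d : a < b -> b < d -> U (sl a b) -> U (sl b d) -> U (sl a d).
  move=> ab bd Uab Ubd.
  have ad := lt_trans ab bd.
  have := Uconv _ _ ((b - a) / (d - a)) Uab Ubd.
  rewrite ler_pdivrMr ?subr_gt0// mul1r lerD2r (ltW bd).
  rewrite divr_ge0 ?subr_ge0 ?ltW// => /(_ isT isT).
  rewrite /sl !scalerA.
  have -> : (b - a) / (d - a) / (b - a) = (d - a)^-1.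
    by field; rewrite !subr_eq0 !gt_eqF.
  have -> : (1 - (b - a) / (d - a)) / (d - b) = (d - a)^-1.
    by field; rewrite !subr_eq0 !gt_eqF.
  by rewrite -scalerDr [c b - c a + _]addrC addrA subrK.
have near_sl s : 0 <= s -> s <= 1 -> exists2 e, 0 < e &
    forall t, t != s -> `|t - s| < e -> U (sl s t) /\ U (sl t s).
  move=> s0 s1; have := dc s s0 s1.
  rewrite /dnbhs /within => /nbhs_ballP[e /= e0 eU].
  exists e => // t ts tse.
  have : U (sl s t).
    have := eU (t - s); rewrite /ball /= sub0r normrN subrK => /(_ tse).
    by apply; rewrite subr_eq0.
  split => //; suff -> : sl t s = sl s t by [].
  by rewrite /sl -(opprB t s) invrN scaleNr -scalerN opprB.
pose S := [set s : R | [/\ 0 < s, s <= 1 & U (sl 0 s)]].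
have S0 : S !=set0.
  have [e e0 eU] := near_sl 0 (lexx _) ler01.
  exists (Num.min 1 (e / 2)).
  have m0 : 0 < Num.min 1 (e / 2) by rewrite lt_min ltr01 divr_gt0.
  split; rewrite ?ge_min ?lexx//.
  apply: (eU _ _ _).1; rewrite ?gt_eqF// subr0 gtr0_norm// gt_min.
  by apply/orP; right; lra.
have S1 : ubound S 1 by move=> s [].
have supS : has_sup S by split => //; exists 1.
pose t := sup S.
have t0 : 0 < t.
  case: S0 => s Ss; case: (Ss) => s0 _ _; apply: (lt_le_trans s0).
  exact: (sup_upper_bound supS).
have t1 : t <= 1 by apply: ge_sup.
have [e e0 eU] := near_sl t (ltW t0) t1.
have Ut : U (sl 0 t).
  have [s Ss tes] := sup_adherent e0 supS.
  have st : s <= t := sup_upper_bound supS Ss.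
  case: Ss => s0 s1 Us.
  move: st; rewrite le_eqVlt => /predU1P[<-//|st].
  apply: (slD 0 s t) => //; apply: (eU s _ _).2; first by rewrite lt_eqF.
  rewrite ltr0_norm ?subr_lt0//; rewrite -/t in tes; lra.
suff t1E : t = 1 by move: Ut; rewrite t1E /sl subr0 invr1 scale1r.
apply: contrapT => /eqP t1N.
have {}t1 : t < 1 by rewrite lt_neqAle t1N.
pose s := Num.min 1 (t + e / 2).
have ts : t < s by rewrite lt_min t1/=; lra.
have se : s - t < e by rewrite ltrBlDr gt_min; apply/orP; right; lra.
suff /(sup_upper_bound supS) : S s by rewrite leNgt ts.
split; rewrite ?(lt_trans t0)// ?ge_min ?lexx//.
apply: (slD 0 t s) => //; apply: (eU s _ _).1; first by rewrite gt_eqF.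
by rewrite gtr0_norm ?subr_gt0.
Qed.

End mean_value.

(** * Difference quotients and directional derivatives *)

Section derivative.
Context {R : realType}.
Implicit Types E F G : tvsType R.

Definition is_ddir E F (f : E -> F) (x v : E) (l : F) : Prop :=
  dquot f x v h @[h --> (0 : R)^'] --> l.

Lemma ddirP E F (f : E -> F) x v : has_ddir f x v -> is_ddir f x v (ddir f x v).
Proof. by move=> h; exact: (xgetPex 0 h). Qed.

Lemma ddirE E F (f : E -> F) x v l : hausdorff_space F ->
  is_ddir f x v l -> ddir f x v = l.
Proof.
move=> hF fl; apply: (cvg_unique hF) (fl).
by apply: ddirP; exists l.
Qed.

(** Joint continuity of the vector space operations, in the one form needed
    below. *)
Lemma cvg_comb E T (S : set_system T) (k : T -> R) (u w : T -> E)
    (k0 : R) (u0 w0 : E) :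
  Filter S -> k t @[t --> S] --> k0 -> u t @[t --> S] --> u0 ->
  w t @[t --> S] --> w0 -> (k t *: u t + w t) @[t --> S] --> k0 *: u0 + w0.
Proof.
move=> FS ck cu cw.
have cku : k t *: u t @[t --> S] --> k0 *: u0.
  apply: (@cvg_comp _ _ _ (fun t => (k t, u t)) (fun p : R^o * E => p.1 *: p.2)
    _ (nbhs (k0 : R^o, u0))); first exact: (cvg_pair ck cu).
  exact: (@scale_continuous R E (k0, u0)).
apply: (@cvg_comp _ _ _ (fun t => (k t *: u t, w t)) (fun p : E * E => p.1 + p.2)
  _ (nbhs (k0 *: u0, w0))); first exact: (cvg_pair cku cw).
exact: (@add_continuous E (k0 *: u0, w0)).
Qed.

Lemma cvg_id_dnbhs : h @[h --> (0 : R)^'] --> (0 : R).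
Proof. exact: nbhs_dnbhs. Qed.

Lemma cvg_line E (x v : E) : (h *: v + x) @[h --> (0 : R)^'] --> x.
Proof.
have := cvg_comb (dnbhs_filter _) cvg_id_dnbhs (cvg_cst v) (cvg_cst x).
by rewrite scale0r add0r; apply.
Qed.

Lemma dnbhs0P (P : set R) : (\forall h \near (0 : R)^', P h) <->
  exists2 e, 0 < e & forall h, h != 0 -> `|h| < e -> P h.
Proof.
rewrite /dnbhs /within; split.
  move=> /nbhs_ballP[e /= e0 eP]; exists e => // h h0 he.
  by apply: eP => //; rewrite /ball /= sub0r normrN.
move=> [e e0 eP]; apply/nbhs_ballP; exists e => //= h.
by rewrite /ball /= sub0r normrN => he h0; exact: eP.
Qed.

(** For (y, w, t) near (x, v, 0) the segment from y to y + t w stays in the region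
    where the derivative in the direction w lies in a given convex neighbourhood
    of the derivative at (x, v); the mean value theorem along that segment puts
    the difference quotient in the same neighbourhood. *)
Lemma dquot_near E F (A : set E) (f : E -> F) x v (U : set F) :
  open A -> A x -> (forall y w, A y -> has_ddir f y w) ->
  {for (x, v), continuous (fun p => ddir f p.1 p.2)} ->
  nbhs (ddir f x v) U ->
  \forall p \near ((x, v), (0 : R)), p.2 != 0 -> U (dquot f p.1.1 p.1.2 p.2).
Proof.
move=> Ao Ax df cdf /locally_convex_nbhs[V [Vo Vx VU Vconv]].
have : \forall p \near ((x, v), (0 : R)),
    A (p.2 *: p.1.2 + p.1.1) /\ V (ddir f (p.2 *: p.1.2 + p.1.1) p.1.2).
  pose m (p : E * E * R) := (p.2 *: p.1.2 + p.1.1, p.1.2).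
  have cm : m p @[p --> ((x, v), (0 : R))] --> (x, v).
    apply: cvg_pair => /=; last first.
      by apply: (@cvg_comp _ _ _ fst snd); [exact: cvg_fst|exact: cvg_snd].
    have := @cvg_comb E (E * E * R)%type (nbhs ((x, v), (0 : R)))
      (fun p => p.2) (fun p => p.1.2) (fun p => p.1.1) 0 v x.
    rewrite scale0r add0r; apply; first exact: cvg_snd.
      by apply: (@cvg_comp _ _ _ fst snd); [exact: cvg_fst|exact: cvg_snd].
    by apply: (@cvg_comp _ _ _ fst fst); [exact: cvg_fst|exact: cvg_fst].
  have : nbhs (x, v) [set q | A q.1 /\ V (ddir f q.1 q.2)].
    apply: filterI.
      by apply: (@cvg_fst _ _ (nbhs x) (nbhs v)); exact: open_nbhs_nbhs.
    by apply: cdf; exact: open_nbhs_nbhs.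
  by move=> /cm.
move=> [[N D]] /= [Nxv /nbhs_ballP[d /= d0 dD]] NDV.
(* A ball around 0 contains s t as soon as it contains t, for s in [0, 1]. *)
exists (N, ball (0 : R) d) => /=; first by split => //; exact: nbhsx_ballx.
move=> [[y w] t] /= [Nyw td] t0; apply: VU.
have ND s : 0 <= s -> s <= 1 ->
    A ((s * t) *: w + y) /\ V (ddir f ((s * t) *: w + y) w).
  move=> s0 s1; apply: (NDV (y, w, s * t)); split => //=; apply: dD.
  move: td; rewrite /ball /= !sub0r !normrN normrM (ger0_norm s0).
  by apply: le_lt_trans; rewrite ler_piMl.
have := @mean_value R F V (fun s => t^-1 *: f ((s * t) *: w + y)) Vconv.
rewrite mul1r mul0r scale0r add0r -scalerBr; apply => s s0 s1.
have [Asy Vsy] := ND s s0 s1.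
have : \forall h \near (0 : R)^', V (dquot f ((s * t) *: w + y) w h).
  by apply: (ddirP (df _ w Asy)); exact: open_nbhs_nbhs.
move=> /dnbhs0P[e e0 eV]; apply/dnbhs0P; exists (e / `|t|).
  by rewrite divr_gt0 ?normr_gt0.
move=> h h0 he; rewrite -scalerBr scalerA -invfM mulrDl scalerDl -addrA mulrC.
rewrite [(t * h)%R]mulrC; apply: eV; first by rewrite mulf_neq0.
by rewrite normrM -ltr_pdivlMr ?normr_gt0.
Qed.

(** [dquot_near] along an arbitrary filter, the form in which it applies to base
    points and directions that depend on the step. *)
Lemma dquot_cvg E F T (S : set_system T) (A : set E) (f : E -> F) x v
    (y w : T -> E) (t : T -> R) :
  open A -> A x -> (forall y w, A y -> has_ddir f y w) ->
  {for (x, v), continuous (fun p => ddir f p.1 p.2)} -> Filter S ->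
  y s @[s --> S] --> x -> w s @[s --> S] --> v -> t s @[s --> S] --> (0 : R) ->
  (\forall s \near S, t s != 0) ->
  dquot f (y s) (w s) (t s) @[s --> S] --> ddir f x v.
Proof.
move=> Ao Ax df cdf FS cy cw ct nt U /(dquot_near Ao Ax df cdf) UV.
have : ((y s, w s), t s) @[s --> S] --> ((x, v), (0 : R)).
  exact: (cvg_pair (cvg_pair cy cw) ct).
move=> /(_ _ UV) /= H.
change (S [set s | U (dquot f (y s) (w s) (t s))]).
by apply: (@filterS2 T S FS _ _ _ _ H nt) => s /= Us /Us.
Qed.

Lemma near_is_ddir E F (f g : E -> F) x v l : (\forall y \near x, f y = g y) ->
  is_ddir f x v l -> is_ddir g x v l.
Proof.
move=> fg; apply: cvg_trans; apply: near_eq_cvg.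
have := @cvg_line E x v _ fg; rewrite /nbhs /=; apply: filterS => h fgh.
by rewrite /dquot fgh (nbhs_singleton fg).
Qed.

Lemma near_ddir E F (f g : E -> F) x v : (\forall y \near x, f y = g y) ->
  ddir f x v = ddir g x v.
Proof.
move=> fg; rewrite /ddir; congr xget; apply/seteqP.
split=> l; apply: near_is_ddir => //.
by near do apply/esym.
Unshelve. all: by end_near. Qed.

End derivative.

(** * Maps of class C^n on locally convex spaces *)

Section smooth_calculus.
Context {R : realType}.
Implicit Types E F G : tvsType R.

Lemma hausdorff_prod (E F : topologicalType) :
  hausdorff_space E -> hausdorff_space F -> hausdorff_space (E * F)%type.
Proof.
move=> hE hF [x y] [x' y'] c; congr pair.
  apply: hE => A B xA xB; have [||[u w] [[/= Au _] [/= Bu _]]] :=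
    c (A `*` setT) (B `*` setT); last by exists u.
    by exists (A, setT) => //=; split => //; exact: filterT.
  by exists (B, setT) => //=; split => //; exact: filterT.
apply: hF => A B xA xB; have [||[u w] [[/= _ Au] [/= _ Bu]]] :=
  c (setT `*` A) (setT `*` B); last by exists w.
  by exists (setT, A) => //=; split => //; exact: filterT.
by exists (setT, B) => //=; split => //; exact: filterT.
Qed.

Lemma open_fst (E F : topologicalType) (A : set E) : open A ->
  open [set p : E * F | A p.1].
Proof.
move=> Ao; rewrite openE => -[x y] /= Ax.
by apply: (@cvg_fst _ _ (nbhs x) (nbhs y)); exact: open_nbhs_nbhs.
Qed.

Lemma Cn_continuous n E F (A : set E) (f : E -> F) x :
  Cn n A f -> A x -> {for x, continuous f}.
Proof. by case: n => [|n] [cf _]; exact: cf. Qed.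

Lemma Cn_has_ddir n E F (A : set E) (f : E -> F) x v :
  Cn n.+1 A f -> A x -> has_ddir f x v.
Proof. by move=> [_ [df _]]; exact: df. Qed.

Lemma Cn_ddir_continuous n E F (A : set E) (f : E -> F) x v :
  Cn n.+1 A f -> A x -> {for (x, v), continuous (fun p => ddir f p.1 p.2)}.
Proof. by move=> [_ [_ cf]] Ax; exact: (Cn_continuous cf). Qed.

Lemma Cn_cvg_ddir n E F (A : set E) (f : E -> F) x v :
  Cn n.+1 A f -> A x -> is_ddir f x v (ddir f x v).
Proof. by move=> fC Ax; apply: ddirP; exact: Cn_has_ddir fC Ax. Qed.
Arguments Cn_cvg_ddir [n E F A f x] v.

(** The difference quotient of the composite is a difference quotient of [g] at
    the fixed point [f x], in a direction that tends to the derivative of [f]. *)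
Lemma is_ddir_comp E F G (A : set E) (B : set F) (f : E -> F) (g : F -> G) x v :
  open B -> Cn 1 A f -> Cn 1 B g -> A x -> B (f x) ->
  is_ddir (g \o f) x v (ddir g (f x) (ddir f x v)).
Proof.
move=> Bo fC gC Ax Bfx.
have c : dquot g (f x) (dquot f x v h) h @[h --> (0 : R)^'] -->
    ddir g (f x) (ddir f x v).
  exact: (dquot_cvg Bo Bfx (fun y w => @Cn_has_ddir 0 _ _ _ _ y w gC)
    (@Cn_ddir_continuous 0 _ _ _ _ _ (ddir f x v) gC Bfx) _
    (cvg_cst _) (Cn_cvg_ddir v fC Ax) cvg_id_dnbhs (nbhs_dnbhs_neq _)).
move: c; apply: cvg_trans; apply: near_eq_cvg.
have := nbhs_dnbhs_neq (0 : R); apply: filterS => h h0.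
by rewrite /dquot /= scalerA divff// scale1r subrK.
Qed.

Lemma ddir_comp E F G (A : set E) (B : set F) (f : E -> F) (g : F -> G) x v :
  hausdorff_space G -> open B -> Cn 1 A f -> Cn 1 B g -> A x -> B (f x) ->
  ddir (g \o f) x v = ddir g (f x) (ddir f x v).
Proof.
by move=> hG Bo fC gC Ax Bfx; apply: ddirE => //; exact: (is_ddir_comp Bo fC gC).
Qed.

(** The increment of [f] from x to x + h (a u + v) is split at x + h v; the first
    part is a difference quotient based at a moving point. *)
Lemma ddir_linear E F (A : set E) (f : E -> F) x a u v :
  hausdorff_space F -> open A -> Cn 1 A f -> A x ->
  ddir f x (a *: u + v) = a *: ddir f x u + ddir f x v.
Proof.
move=> hF Ao fC Ax; apply: ddirE => //.
have [->|a0] := eqVneq a 0.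
  by rewrite !scale0r !add0r; exact: Cn_cvg_ddir fC Ax.
have ah : (a * h) @[h --> (0 : R)^'] --> (0 : R).
  have := @cvgM R R ((0 : R)^') _ (fun=> a) id _ _ (cvg_cst _) cvg_id_dnbhs.
  by rewrite mulr0; apply.
have cu : dquot f (h *: v + x) u (a * h) @[h --> (0 : R)^'] --> ddir f x u.
  apply: (dquot_cvg Ao Ax (fun y w => @Cn_has_ddir 0 _ _ _ _ y w fC)
    (@Cn_ddir_continuous 0 _ _ _ _ _ u fC Ax) _
    (y := fun h => h *: v + x) (w := fun=> u) (t := fun h => a * h)).
  - exact: cvg_line.
  - exact: cvg_cst.
  - exact: ah.
  have := nbhs_dnbhs_neq (0 : R); apply: filterS => h h0.
  by rewrite mulf_neq0.
have : (a *: dquot f (h *: v + x) u (a * h) + dquot f x v h)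
    @[h --> (0 : R)^'] --> a *: ddir f x u + ddir f x v.
  by apply: cvg_comb; [exact: cvg_cst|exact: cu|exact: Cn_cvg_ddir v fC Ax].
apply: cvg_trans; apply: near_eq_cvg.
have := nbhs_dnbhs_neq (0 : R); apply: filterS => h h0.
rewrite /dquot scalerA invfM mulrA divff// mul1r -scalerDr subrKA.
by rewrite [h *: (_ + v)]scalerDr [h *: (a *: u)]scalerA [h * a]mulrC addrA.
Qed.

Lemma near_continuous (S T : topologicalType) (f g : S -> T) x :
  (\forall y \near x, f y = g y) ->
  {for x, continuous g} -> {for x, continuous f}.
Proof.
move=> fg cg; change (f y @[y --> x] --> f x); rewrite (nbhs_singleton fg).
by apply: cvg_trans cg; apply: near_eq_cvg; apply: filterS fg => y ->.
Qed.

(** A directional derivative only depends on the values of the map near the base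
    point, so [f] may be replaced near each point by a map [g] known to be C^n. *)
Lemma Cn_local n E F (A : set E) (f : E -> F) :
  (forall x, A x -> exists V g, [/\ open V, V x,
     forall y, V y -> f y = g y & Cn n V g]) -> Cn n A f.
Proof.
have near_fg (S : topologicalType) T (V : set S) (g h : S -> T) x : open V -> V x ->
    (forall y, V y -> g y = h y) -> \forall y \near x, g y = h y.
  by move=> Vo Vx gh; apply: filterS (open_nbhs_nbhs (conj Vo Vx)).
elim: n E A f => [|n IH] E A f loc.
  split => // x /loc[V [g [Vo Vx fg gC]]].
  exact: near_continuous (near_fg _ _ _ _ _ _ Vo Vx fg) (Cn_continuous gC Vx).
split; [|split].
- move=> x /loc[V [g [Vo Vx fg gC]]].
  exact: near_continuous (near_fg _ _ _ _ _ _ Vo Vx fg) (Cn_continuous gC Vx).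
- move=> x v /loc[V [g [Vo Vx fg gC]]].
  exists (ddir g x v); apply: near_is_ddir (Cn_cvg_ddir v gC Vx).
  by apply: filterS (near_fg _ _ _ _ _ _ Vo Vx fg) => y ->.
- apply: IH => -[x v] /= /loc[V [g [Vo Vx fg gC]]].
  exists [set p | V p.1], (fun p => ddir g p.1 p.2); split => //.
  + exact: open_fst.
  + by move=> [y w] /= Vy; apply: near_ddir; exact: near_fg Vo Vy fg.
  + by case: gC => _ [].
Qed.

Lemma Cn_eq n E F (A : set E) (f g : E -> F) :
  open A -> (forall x, A x -> f x = g x) -> Cn n A g -> Cn n A f.
Proof. by move=> Ao fg gC; apply: Cn_local => x Ax; exists A, g. Qed.

Lemma Cn_sub n E F (A B : set E) (f : E -> F) :
  A `<=` B -> Cn n B f -> Cn n A f.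
Proof.
elim: n E A B f => [|n IH] E A B f AB [cf fC]; first by split => // x /AB/cf.
split; [by move=> x /AB/cf|split; first by move=> x v /AB; exact: fC.1].
by apply: (IH _ _ _ _ _ fC.2) => -[x v] /AB.
Qed.

Lemma CnS n E F (A : set E) (f : E -> F) : Cn n.+1 A f -> Cn n A f.
Proof.
elim: n E A f => [|n IH] E A f [cf [df fC]]; split => //.
by split => //; exact: IH.
Qed.

Lemma Cn1 n E F (A : set E) (f : E -> F) : Cn n.+1 A f -> Cn 1 A f.
Proof. by elim: n => // n IH /CnS. Qed.

Lemma is_ddir_pair E F G (f : E -> F) (g : E -> G) x v l m :
  is_ddir f x v l -> is_ddir g x v m ->
  is_ddir (fun y => (f y, g y)) x v (l, m).
Proof. by move=> fl gm; exact: (cvg_pair fl gm). Qed.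

Lemma Cn_pair n E F G (A : set E) (f : E -> F) (g : E -> G) :
  hausdorff_space F -> hausdorff_space G -> open A ->
  Cn n A f -> Cn n A g -> Cn n A (fun x => (f x, g x)).
Proof.
move=> hF hG; elim: n E A f g => [|n IH] E A f g Ao fC gC.
  split => // x Ax.
  exact: (cvg_pair (Cn_continuous fC Ax) (Cn_continuous gC Ax)).
have dfg x v : A x ->
    is_ddir (fun y => (f y, g y)) x v (ddir f x v, ddir g x v).
  move=> Ax; apply: is_ddir_pair; first exact: Cn_cvg_ddir fC Ax.
  exact: Cn_cvg_ddir gC Ax.
split; [|split].
- move=> x Ax.
  exact: (cvg_pair (Cn_continuous fC Ax) (Cn_continuous gC Ax)).
- by move=> x v Ax; exists (ddir f x v, ddir g x v); exact: dfg.
- have := IH _ _ _ _ (open_fst (F := E) Ao) fC.2.2 gC.2.2.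
  apply: Cn_eq; first exact: open_fst.
  by move=> [x v] /= Ax; apply: ddirE; [exact: hausdorff_prod|exact: dfg].
Qed.

Lemma Cn_linear n E F (A : set E) (f : E -> F) : hausdorff_space F ->
  (forall a u v, f (a *: u + v) = a *: f u + f v) -> continuous f -> Cn n A f.
Proof.
move=> hF; elim: n E A f => [|n IH] E A f fL cf.
  by split => // x _; exact: cf.
have df x v : is_ddir f x v (f v).
  have : (fun=> f v) h @[h --> (0 : R)^'] --> f v by exact: cvg_cst.
  apply: cvg_trans; apply: near_eq_cvg.
  have := nbhs_dnbhs_neq (0 : R); apply: filterS => h h0.
  by rewrite /dquot fL addrK scalerA mulVf// scale1r.
split; [by move=> x _; exact: cf|split; first by move=> x v _; exists (f v); exact: df].
have -> : (fun p => ddir f p.1 p.2) = f \o snd.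
  by apply/funext => -[x v]; exact: ddirE.
apply: IH => [a [? ?] [? ?] /=|p]; first exact: fL.
by apply: continuous_comp; [exact: cvg_snd|exact: cf].
Qed.

Lemma Cn_fst n E F (A : set (E * F)) : hausdorff_space E -> Cn n A fst.
Proof. by move=> hE; apply: Cn_linear => // p; exact: cvg_fst. Qed.

Lemma Cn_snd n E F (A : set (E * F)) : hausdorff_space F -> Cn n A snd.
Proof. by move=> hE; apply: Cn_linear => // p; exact: cvg_snd. Qed.

(** By the chain rule the derivative of [g \o f] is the derivative of [g] after
    the map (x, v) |-> (f x, df(x, v)), which is of class C^n if f is of class
    C^(n+1); hence an induction over all spaces at once. *)
Lemma Cn_comp n E F G (A : set E) (B : set F) (f : E -> F) (g : F -> G) :
  hausdorff_space E -> hausdorff_space F -> hausdorff_space G ->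
  open A -> open B -> (forall x, A x -> B (f x)) ->
  Cn n A f -> Cn n B g -> Cn n A (g \o f).
Proof.
elim: n E F G A B f g => [|n IH] E F G A B f g hE hF hG Ao Bo AB fC gC.
  split => // x Ax; apply: continuous_comp; first exact: Cn_continuous fC Ax.
  by apply: Cn_continuous gC _; exact: AB.
split; [|split].
- move=> x Ax; apply: continuous_comp; first exact: Cn_continuous fC Ax.
  by apply: Cn_continuous gC _; exact: AB.
- move=> x v Ax; exists (ddir g (f x) (ddir f x v)).
  by apply: (is_ddir_comp Bo (Cn1 fC) (Cn1 gC)) => //; exact: AB.
- apply: (@Cn_eq _ _ _ _ _
    ((fun q => ddir g q.1 q.2) \o (fun p => (f p.1, ddir f p.1 p.2)))).
  + exact: open_fst.
  + move=> [x v] /= Ax.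
    by apply: (ddir_comp v hG Bo (Cn1 fC) (Cn1 gC)) => //; exact: AB.
  + apply: (IH _ _ _ _ [set q | B q.1]) => //.
    * exact: hausdorff_prod.
    * exact: hausdorff_prod.
    * exact: open_fst.
    * exact: open_fst.
    * by move=> [x v] /= /AB.
    * apply: Cn_pair => //; [exact: open_fst| |exact: fC.2.2].
      apply: (IH _ _ _ _ A fst f) => //; [exact: hausdorff_prod|exact: open_fst| |].
        exact: Cn_fst.
      exact: CnS.
    * exact: gC.2.2.
Qed.

End smooth_calculus.

(** * Action of a smooth map on tuples of tangent vectors *)

Section tangent_powers.
Context {R : realType}.
Implicit Types E F : tvsType R.

(** The map induced by [f] on a point together with k tangent vectors.  A k-form
    in a chart is a function on such tuples, and its pullback is the composite
    with this map. *)
Fixpoint tangent_pow E F (f : E -> F) (k : nat) : pow E k -> pow F k :=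
  match k with
  | 0 => f
  | k'.+1 => fun p => (@tangent_pow E F f k' p.1, ddir f (pow_base p.1) p.2)
  end.
Arguments tangent_pow {E F} f k _.

Lemma pow_base_tangent E F (f : E -> F) k (p : pow E k) :
  pow_base (tangent_pow f k p) = f (pow_base p).
Proof. by elim: k p => //= k IH p; exact: IH. Qed.

Lemma pow_vec_tangent E F (f : E -> F) k (p : pow E k) l : (l < k)%N ->
  pow_vec (tangent_pow f k p) l = ddir f (pow_base p) (pow_vec p l).
Proof.
elim: k p => //= k IH p; rewrite ltnS leq_eqVlt.
by case: eqP => //= _; exact: IH.
Qed.

Lemma hausdorff_pow E k : hausdorff_space E -> hausdorff_space (pow E k).
Proof. by move=> hE; elim: k => //= k IH; exact: hausdorff_prod. Qed.

Lemma open_pow_base E k (A : set E) : open A ->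
  open [set p : pow E k | A (pow_base p)].
Proof. by move=> Ao; elim: k => //= k IH; exact: (open_fst IH). Qed.

Lemma Cn_pow_base n E k (A : set (pow E k)) : hausdorff_space E ->
  Cn n A (fun p => pow_base p).
Proof.
move=> hE; apply: (@Cn_sub _ _ _ _ _ setT) => //.
elim: k {A} => [|k IH].
  by apply: Cn_linear => // x; exact: cvg_id.
apply: (Cn_comp (F := pow E k) (B := setT) (f := fst)) => //.
- by apply: hausdorff_prod => //; exact: hausdorff_pow.
- exact: hausdorff_pow.
- exact: openT.
- exact: openT.
- by apply: Cn_fst; exact: hausdorff_pow.
Qed.

Lemma smooth_tangent_pow E F (A : set E) (f : E -> F) k :
  hausdorff_space E -> hausdorff_space F -> open A -> smooth_on A f ->
  smooth_on [set p : pow E k | A (pow_base p)] (tangent_pow f k).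
Proof.
move=> hE hF Ao fC n; elim: k => [|k IH]; first exact: fC.
have hEk := @hausdorff_pow E k hE.
have hEk1 : hausdorff_space (pow E k * E)%type by exact: hausdorff_prod.
have Ak := @open_pow_base E k A Ao.
have Ak1 := open_fst (F := E) Ak.
apply: Cn_pair => //; first exact: hausdorff_pow.
  apply: (Cn_comp (B := [set p : pow E k | A (pow_base p)]) (f := fst)) => //.
    exact: hausdorff_pow.
  exact: Cn_fst.
apply: (Cn_comp (B := [set q : E * E | A q.1])
  (f := fun p : pow E k * E => (pow_base p.1, p.2))
  (g := fun q => ddir f q.1 q.2)) => //.
- exact: hausdorff_prod.
- exact: open_fst.
- apply: Cn_pair => //; last exact: Cn_snd.
  exact: (@Cn_pow_base n E k.+1).
- exact: (fC n.+1).2.2.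
Qed.

End tangent_powers.
Arguments tangent_pow {R E F} f k _.

(** * Smooth maps between manifolds *)

Section smooth_maps.
Context {R : realType}.
Implicit Types L M N P : manifold R.

Lemma model_hausdorff M (i : chart M) : hausdorff_space (model i).
Proof. exact: frechet_hausdorff. Qed.
Hint Resolve model_hausdorff : core.

Lemma imgP M (U : set M) (i : chart M) x :
  img U i x <-> [/\ dom i (psi i x), U (psi i x) & phi i (psi i x) = x].
Proof.
split; last by move=> [ix Ux <-]; exists (psi i x).
by move=> [p [ip Up] <-]; rewrite phiK.
Qed.

Lemma open_img M (U : set M) (i : chart M) : open U -> open (img U i).
Proof.
move=> Uo; rewrite openE => x /imgP[ix Ux xE].
have dx : (phi i @` dom i) x by exists (psi i x).
have : nbhs x ((phi i @` dom i) `&` psi i @^-1` U).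
  apply: filterI.
    by apply: open_nbhs_nbhs; split => //; exact: img_open.
  by apply: (psi_continuous dx); exact: open_nbhs_nbhs.
by apply: filterS => y [[p ip <-]]; rewrite /preimage /= phiK // => Up; exists p.
Qed.

Lemma open_preimage M N (f : M -> N) (U : set N) : smooth_map f -> open U ->
  open (f @^-1` U).
Proof. by move=> [cf _] Uo; apply: open_comp => // x _; exact: cf. Qed.

Lemma smooth_map_id M : smooth_map (@id M).
Proof. by split => [x|i j]; [exact: cvg_id|exact: transition_smooth]. Qed.

(** The domain on which a composite, read in charts, is the composite of the maps
    read in charts through the intermediate chart [j]. *)
Lemma near_chart_comp L M N (f : L -> M) (g : M -> N) i j l x :
  smooth_map f -> smooth_map g -> img setT i x ->
  dom j (f (psi i x)) -> dom l (g (f (psi i x))) ->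
  [/\ open (img (f @^-1` (dom j `&` g @^-1` dom l)) i),
      img (f @^-1` (dom j `&` g @^-1` dom l)) i x &
      forall y, img (f @^-1` (dom j `&` g @^-1` dom l)) i y ->
        img (g @^-1` dom l) j (phi j (f (psi i y))) /\
        (phi l \o (g \o f) \o psi i) y =
        ((phi l \o g \o psi j) \o (phi j \o f \o psi i)) y].
Proof.
move=> fs gs /imgP[ix _ xE] jx lx; split.
- apply: open_img; apply: open_preimage => //.
  by apply: openI; [exact: dom_open|apply: open_preimage => //; exact: dom_open].
- exact/imgP.
- move=> y /imgP[iy [jy ly] yE]; split; last by rewrite /= phiK.
  by exists (f (psi i y)).
Qed.

(** The chain rule on manifolds.  With [g] or [f] the identity it also covers a
    change of chart on either side. *)
Lemma ddir_chart_comp L M N (f : L -> M) (g : M -> N) i j l x v :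
  smooth_map f -> smooth_map g -> img setT i x ->
  dom j (f (psi i x)) -> dom l (g (f (psi i x))) ->
  ddir (phi l \o (g \o f) \o psi i) x v =
  ddir (phi l \o g \o psi j) (phi j (f (psi i x)))
       (ddir (phi j \o f \o psi i) x v).
Proof.
move=> fs gs ix jx lx; have [Vo Vx VE] := near_chart_comp fs gs ix jx lx.
rewrite (@near_ddir _ _ _ _ ((phi l \o g \o psi j) \o (phi j \o f \o psi i))).
  apply: (ddir_comp v _ (open_img _ (open_preimage gs (dom_open _)))
    (fs.2 i j 1) (gs.2 j l 1)) => //.
    by case/imgP: ix => ? _ ?; exact/imgP.
  exact: (VE x Vx).1.
by apply: filterS (open_nbhs_nbhs (conj Vo Vx)) => y /VE[].
Qed.

Lemma smooth_map_comp L M N (f : L -> M) (g : M -> N) :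
  smooth_map f -> smooth_map g -> smooth_map (g \o f).
Proof.
move=> fs gs; split=> [x|i l n].
  by apply: continuous_comp; [exact: fs.1|exact: gs.1].
apply: Cn_local => x /imgP[ix lx xE].
pose j := chart_at (f (psi i x)).
have [|||Vo Vx VE] := @near_chart_comp _ _ _ f g i j l x fs gs.
- exact/imgP.
- exact: dom_chart_at.
- by [].
exists (img (f @^-1` (dom j `&` g @^-1` dom l)) i),
  ((phi l \o g \o psi j) \o (phi j \o f \o psi i)); split => //.
  by move=> y /VE[].
apply: (Cn_comp (B := img (g @^-1` dom l) j)) => //.
- by apply: open_img; apply: open_preimage => //; exact: dom_open.
- by move=> y /VE[].
- apply: Cn_sub (fs.2 i j n) => y /imgP[iy [jy _] yE]; exact/imgP.
- exact: gs.2.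
Qed.

End smooth_maps.

(** * Pullback of differential forms *)

Section forms.
Context {R : realType}.
Implicit Types L M N P : manifold R.
Hint Resolve model_hausdorff : core.

Lemma real_hausdorff : hausdorff_space (R^o : tvsType R).
Proof. exact: (@norm_hausdorff R R^o). Qed.
Hint Resolve real_hausdorff : core.

(** [pull_form] reads the form in one chosen chart around each image point.  The
    compatibility of a form with changes of chart makes the choice immaterial,
    so that a single chart can be used near a point. *)
Lemma pull_formE k M N (f : M -> N) (w : preform k N) (i : chart M) j x v :
  smooth_map f -> is_form w -> img setT i x -> dom j (f (psi i x)) ->
  pull_form f w i x v =
  w j (phi j (f (psi i x))) (fun l => ddir (phi j \o f \o psi i) x (v l)).
Proof.
move=> fs [_ _ _ wE] ix jx; rewrite /pull_form.
set j' := chart_at _.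
have j'x : dom j' (f (psi i x)) by exact: dom_chart_at.
rewrite (wE j' j); last by exists (f (psi i x)).
rewrite phiK //; congr (w j _ _); apply/funext => l.
by rewrite -(ddir_chart_comp _ fs (@smooth_map_id _ N) ix j'x jx).
Qed.

Lemma pull_form_comp k L M N (f : L -> M) (g : M -> N) (w : preform k N) :
  smooth_map f -> smooth_map g -> is_form w ->
  eqform (pull_form f (pull_form g w)) (pull_form (g \o f) w).
Proof.
move=> fs gs wf i x v ix.
have jx := dom_chart_at (f (psi i x)).
have lx := dom_chart_at (g (f (psi i x))).
rewrite {1}/pull_form (pull_formE (j := chart_at (g (f (psi i x)))) _ gs wf).
- rewrite phiK // /pull_form /=; congr (w _ _ _); apply/funext => l.
  by rewrite (ddir_chart_comp _ fs gs ix jx lx).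
- by exists (f (psi i x)).
- by rewrite phiK.
Qed.

(** Multilinearity is the linearity of the derivative; smoothness holds because
    near a point a single target chart can be used, and then the pullback is a
    composite of smooth maps; compatibility with changes of chart is the chain
    rule. *)
Lemma is_form_pull k M N (f : M -> N) (w : preform k N) :
  smooth_map f -> is_form w -> is_form (pull_form f w).
Proof.
move=> fs wf; have [wlin walt ws wE] := wf; split.
- move=> i x v l a u u' ix.
  have jx := dom_chart_at (f (psi i x)).
  rewrite /pull_form; set j := chart_at _ in jx *; set y := phi j _.
  set D := ddir (phi j \o f \o psi i) x.
  have Dsubst b : (fun l' => D (subst_vec v l b l')) =
      subst_vec (fun l' => D (v l')) l (D b).
    by apply/funext => l'; rewrite /subst_vec; case: eqP.
  have DL : D (a *: u + u') = a *: D u + D u'.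
    apply: (ddir_linear _ _ _ _ (open_img i (open_preimage fs (dom_open j)))
      (fs.2 i j 1)) => //.
    by case/imgP: ix => ? _ ?; apply/imgP.
  rewrite (Dsubst (a *: u + u')) (Dsubst u) (Dsubst u') DL.
  by apply: wlin; exists (f (psi i x)).
- move=> i x v l l' ix ll' vv; rewrite /pull_form.
  apply: (walt _ _ _ l l') => //; last by rewrite vv.
  by exists (f (psi i x)) => //; split => //; exact: dom_chart_at.
- move=> i n; apply: Cn_local => p /imgP[ip _ pE].
  set x := pow_base p in ip pE; pose j := chart_at (f (psi i x)).
  have fo : open (img (f @^-1` dom j) i).
    by apply: open_img; apply: open_preimage => //; exact: dom_open.
  exists [set q : pow (model i) k | img (f @^-1` dom j) i (pow_base q)],
    ((fun q => w j (pow_base q) (fun l : 'I_k => pow_vec q l) : R^o) \o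
     tangent_pow (phi j \o f \o psi i) k); split.
  + exact: open_pow_base.
  + by apply/imgP; split => //; exact: dom_chart_at.
  + move=> q /= /imgP[iq jq qE]; rewrite (pull_formE (j := j)) //.
      rewrite pow_base_tangent; congr (w j _ _); apply/funext => l.
      by rewrite pow_vec_tangent.
    exact/imgP.
  + apply: (Cn_comp (B := [set q : pow (model j) k | img setT j (pow_base q)])).
    * exact: hausdorff_pow.
    * exact: hausdorff_pow.
    * exact: real_hausdorff.
    * exact: open_pow_base.
    * by apply: open_pow_base; apply: open_img; exact: openT.
    * move=> q /imgP[iq jq qE] /=; rewrite pow_base_tangent /=.
      by exists (f (psi i (pow_base q))).
    * by apply: smooth_tangent_pow => //; exact: fs.2.
    * exact: ws.
- move=> i j x v /imgP[ix [_ jx] xE].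
  have lx := dom_chart_at (f (psi i x)); set l := chart_at _ in lx.
  have ix' : img setT i x by exact/imgP.
  rewrite (pull_formE (j := l)) // (pull_formE (j := l)) //.
  + rewrite phiK //; congr (w l _ _); apply/funext => m.
    by rewrite -(ddir_chart_comp _ (@smooth_map_id _ M) fs ix' jx lx).
  + by exists (psi i x).
  + by rewrite phiK.
Qed.

Lemma Cn_axpy n (E : tvsType R) (A : set E) (a : R) (f g : E -> R^o) :
  hausdorff_space E -> open A ->
  Cn n A f -> Cn n A g -> Cn n A (fun x => a * f x + g x : R^o).
Proof.
move=> hE Ao fC gC.
apply: (Cn_comp (B := setT) (f := fun x => (f x, g x))
  (g := fun q : R^o * R^o => a * q.1 + q.2 : R^o)) => //.
- exact: openT.
- exact: (Cn_pair real_hausdorff real_hausdorff Ao fC gC).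
- apply: Cn_linear => // [b [u1 u2] [v1 v2] /=|q].
    by rewrite /GRing.scale /=; ring.
  apply: (@cvg_comb R R^o _ (nbhs q) (fun=> a) fst snd).
  + exact: cvg_cst.
  + exact: cvg_fst.
  + exact: cvg_snd.
Qed.

Lemma Cn_sum n (E : tvsType R) (A : set E) m (c : 'I_m -> R)
    (f : 'I_m -> E -> R^o) :
  hausdorff_space E -> open A -> (forall l, Cn n A (f l)) ->
  Cn n A (fun x => \sum_(l < m) c l * f l x : R^o).
Proof.
move=> hE Ao; elim: m c f => [|m IH] c f fC.
  under eq_fun do rewrite big_ord0.
  by apply: Cn_linear => [//|a u v|q]; [rewrite scaler0 addr0|exact: cvg_cst].
under eq_fun do rewrite big_ord_recl.
by apply: Cn_axpy => //; apply: IH.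
Qed.

Lemma is_form_sum k M n (c : 'I_n -> R) (w : 'I_n -> preform k M) :
  (forall l, is_form (w l)) ->
  is_form (fun i x v => \sum_(l < n) c l * w l i x v).
Proof.
move=> wf; split.
- move=> i x v l a u u' ix; rewrite mulr_sumr -big_split; apply: eq_bigr => m _.
  by have [wlin _ _ _] := wf m; rewrite wlin //=; ring.
- move=> i x v l l' ix ll' vv; apply: big1 => m _.
  by have [_ walt _ _] := wf m; rewrite (walt _ _ _ l l') // mulr0.
- move=> i m; apply: Cn_sum => [||l].
  + exact: hausdorff_pow.
  + by apply: open_pow_base; apply: open_img; exact: openT.
  + by have [_ _ ws _] := wf l; exact: ws.
- move=> i j x v ix; apply: eq_bigr => l _.
  by have [_ _ _ wE] := wf l; rewrite (wE i j).
Qed.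

Lemma is_form_delta k M N n (d : 'I_n.+1 -> M -> N) (w : preform k N) :
  (forall l, smooth_map (d l)) -> is_form w -> is_form (delta_form d w).
Proof. by move=> ds wf; apply: is_form_sum => l; exact: is_form_pull. Qed.

(** * The complex of forms on a Čech nerve *)

(** The terms with i <= j and those with j < i are matched by
    (i, j) <-> (j + 1, i), which reverses the sign. *)
Lemma alternating_sum_faces (V : pzRingType) n (F : 'I_n.+2 -> 'I_n.+1 -> V) :
  (forall i j : 'I_n.+1, (i <= j)%N ->
     F (lift ord0 j) i = F (widen_ord (leqnSn n.+1) i) j) ->
  \sum_(i < n.+2) \sum_(j < n.+1) (-1) ^+ i * ((-1) ^+ j * F i j) = 0.
Proof.
move=> FE; pose G (i : 'I_n.+2) (j : 'I_n.+1) := (-1) ^+ i * ((-1) ^+ j * F i j).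
transitivity (\sum_(i < n.+2) (\sum_(j < n.+1 | (i <= j)%N) G i j +
    \sum_(j < n.+1 | (j < i)%N) G i j)).
  apply: eq_bigr => i _; rewrite (bigID (fun j : 'I_n.+1 => (i <= j)%N)) /=.
  by congr (_ + _); apply: eq_bigl => j; rewrite ltnNge.
rewrite big_split /= [X in X + _]big_ord_recr [X in _ + X]big_ord_recl /=.
(* No j satisfies n + 1 <= j in the first sum, or j < 0 in the second. *)
rewrite [X in _ + X + _]big_pred0 => [|j]; last by rewrite leqNgt ltn_ord.
rewrite [X in _ + (X + _)]big_pred0 => [|j]; last by [].
rewrite addr0 add0r [X in _ + X](exchange_big_dep xpredT) //= -big_split /=.
apply: big1 => i _; rewrite -[RHS](addr0 0).
rewrite (eq_bigl (fun j : 'I_n.+1 => (i <= j)%N)); last by [].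
rewrite -big_split /=; rewrite big1 ?addr0 // => j ij.
rewrite /G FE //= /bump /= add1n exprS mulN1r !mulNr.
by rewrite !mulrA -!exprD [(i + j)%N]addnC addrC addNr.
Qed.

Lemma delta_delta_form k L M N n (d' : 'I_n.+2 -> L -> M) (d : 'I_n.+1 -> M -> N)
    (w : preform k N) :
  (forall i, smooth_map (d' i)) -> (forall i, smooth_map (d i)) -> is_form w ->
  (forall (i j : 'I_n.+1) z, (i <= j)%N ->
     d i (d' (lift ord0 j) z) = d j (d' (widen_ord (leqnSn n.+1) i) z)) ->
  eqform (delta_form d' (delta_form d w)) (zero_form L).
Proof.
move=> d's ds wf dd i x v ix.
rewrite /zero_form -[RHS](@alternating_sum_faces _ n
  (fun a b => pull_form (d b \o d' a) w i x v)); last first.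
  move=> a b ab; congr (pull_form _ w i x v).
  by apply/funext => z; exact: dd.
apply: eq_bigr => a _; rewrite {1}/pull_form mulr_sumr; apply: eq_bigr => b _.
by congr (_ * (_ * _)); rewrite -(pull_form_comp (d's a) (ds b) wf).
Qed.

(** Both sides are smooth maps into a fibre power with the same components, since
    omitting the factor j + 1 of a tuple and then the factor i gives the same
    tuple as omitting the factor i and then the factor j. *)
Lemma cech_faces (B : manifold R) (Y : precech B) k (i j : 'I_k.+2) (z : Y k.+2) :
  is_cech Y -> (i <= j)%N ->
  face i (face (lift ord0 j) z) = face j (face (widen_ord (leqnSn k.+2) i) z).
Proof.
move=> [_ fib _ fs fp] ij; have [ps paug puniv] := fib k.
pose t l (y : Y k.+2) := Defs.proj l (face i (face (lift ord0 j) y)).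
have tE l y : t l y = Defs.proj l (face j (face (widen_ord (leqnSn k.+2) i) y)).
  rewrite /t !fp; congr (Defs.proj _ _); apply/val_inj.
  by rewrite /= /bump; lia.
have [||u [_ uuniq]] := puniv _ t.
- move=> l; apply: (smooth_map_comp (g := Defs.proj l)); last exact: ps.
  exact: (smooth_map_comp (fs _ _) (fs _ _)).
- by move=> a b y; exact: paug.
have e1 : u = (fun y => face i (face (lift ord0 j) y)).
  by apply: uuniq; split => //; exact: (smooth_map_comp (fs _ _) (fs _ _)).
have e2 : u = (fun y => face j (face (widen_ord (leqnSn k.+2) i) y)).
  apply: uuniq; split=> [|l y]; last by rewrite -tE.
  exact: (smooth_map_comp (fs _ _) (fs _ _)).
have := congr1 (@^~ z) e1; have := congr1 (@^~ z) e2.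
by move=> /= <- <-.
Qed.

End forms.

Theorem propositionA8 (R : realType) (X : manifold R)
    (G : rigid_bundle_2gerbe X)
    (nablaE : preconn (rE G)) (beta : preform 2 (rZ G 1 0))
    (lambda : preform 3 (rY G 0))
    (hG : is_connective_structure nablaE beta lambda) :
  is_stevenson_structure (T := associated_bundle_2gerbe G) nablaE beta lambda.
Proof.
have [conn curv lamf dbeta] := hG.
have [_ _ _ fs _] := rYP G.
split => //; exists (delta_form (@face R X (rY G) 0) lambda); split => //.
  by split => //; exact: is_form_delta (fs 0%N) lamf.
apply: delta_delta_form (fs 1%N) (fs 0%N) lamf _ => i j z ij.
exact: cech_faces (rYP G) ij.
Qed.
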